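(* Let $G$ be a Sylow-cyclic group of order $N$. For any divisor $d$ of $N$, there is a subgroup of $G$ of order $d$, and all subgroups of $G$ of order $d$ are conjugate in $G$.
   Context: A finite group $G$ is called Sylow-cyclic if every Sylow subgroup of $G$ (for every prime dividing $|G|$) is cyclic. *)

(* A nontrivial Sylow-cyclic group G is solvable: if p is the smallest prime
   dividing its order and S is a Sylow p-subgroup, then no prime divisor of
   |G| other than p divides |Aut S|, so N_G(S) centralises S, the transfer
   G -> S is injective on S, and the proper subgroup G' is again Sylow-cyclic.
   Hence G has a minimal normal subgroup A which is elementary abelian and
   cyclic, i.e., of prime order p; it is the only subgroup of order p of G.
   Now argue by induction in G / A: a subgroup of order divisible by p contains
   A, while a subgroup H of order prime to p is a complement of A in A H, and
   the Schur-Zassenhaus theorem applies. *)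
From mathcomp Require Import all_boot all_fingroup all_solvable.
From mathcomp Require Import ssralg.

Set Implicit Arguments.
Unset Strict Implicit.
Unset Printing Implicit Defensive.

Local Open Scope group_scope.

(** Both [S] and [S :^ g] are abelian and contain [x ^ g], so both are Sylow in ['C_G[x ^ g]]. Some
    [c] there conjugates [S :^ g] to [S]; then [g * c] normalises, hence centralises, [S]. *)
Lemma Burnside_fusion_elt (gT : finGroupType) p (G S : {group gT}) x g :
    p.-Sylow(G) S -> abelian S -> 'N_G(S) \subset 'C(S) ->
  x \in S -> g \in G -> x ^ g \in S -> x ^ g = x.
Proof.
move=> sylS abS cNS Sx Gg Sxg; have sSG := pHall_sub sylS.
have sylC (T : {group gT}) : p.-Sylow(G) T -> T \subset 'C[x ^ g] ->
    p.-Sylow('C_G[x ^ g]) T.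
  by move=> sylT cTx; rewrite (pHall_subl _ (subsetIl _ _) sylT) // subsetI
    (pHall_sub sylT).
have sylS1 : p.-Sylow('C_G[x ^ g]) S.
  by apply: sylC => //; rewrite sub_cent1 (subsetP abS).
have sylS2 : p.-Sylow('C_G[x ^ g]) (S :^ g)%G.
  apply: sylC; first by rewrite pHallJ.
  by rewrite cent1J conjSg sub_cent1 (subsetP abS).
have [c /setIP[Gc /cent1P cxc] defS] := Sylow_trans sylS2 sylS1.
have /(subsetP cNS)/centP cgc : g * c \in 'N_G(S).
  by rewrite inE groupM //= inE conjsgM {2}defS.
have : x ^ (g * c) = x by rewrite /conjg -(cgc x Sx) mulKg.
by rewrite conjgM [X in X = _ -> _]conjgE -cxc mulKg.
Qed.

Lemma Burnside_der1_TI (gT : finGroupType) p (G S : {group gT}) :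
    p.-Sylow(G) S -> abelian S -> 'N_G(S) \subset 'C(S) ->
  S :&: G^`(1) = 1.
Proof.
move=> sylS abS cNS; have sSG := pHall_sub sylS.
have abI : abelian (idm S @* S) by rewrite im_idm.
pose V := transfer_morphism G abI.
have sG'K : G^`(1) \subset 'ker V.
  rewrite gen_subG; apply/subsetP=> _ /imset2P[x y Gx Gy ->].
  apply/kerP; first by rewrite groupR.
  by rewrite morphR //; apply/eqP/commgP; apply: GRing.addrC.
apply/trivgP/subsetP=> x /setIP[Sx /(subsetP sG'K)/mker].
have Gx := subsetP sSG x Sx.
have trX := transversalP (rcosets_cycle_partition sSG Gx).
rewrite /= (transfer_cycle_expansion sSG abI Gx trX).
set X := transversal _ _ => VX1.
(* Each orbit of [x] on the cosets, of length [n], contributes a conjugate of [x ^+ n] lying in [S].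
   By fusion this is [x ^+ n] itself, and the lengths add up to the index. *)
have: x ^+ #|G : S| = 1.
  rewrite -(sum_index_rcosets_cycle sSG Gx trX) -/X.
  have /= := congr1 (@FiniteModule.fmval _ _ abI) VX1.
  rewrite FiniteModule.fmval0 FiniteModule.fmval_sum => <-.
  rewrite (big_morph _ (expgD x) (expg0 x)).
  apply: eq_bigr => y Xy.
  set n := #|_ : _|; have Gy : y \in G := subsetP (transversal_sub trX) y Xy.
  have Sxn : x ^+ n \in S by rewrite groupX.
  have Sxny : x ^+ n ^ y^-1 \in S.
    have := mulg_exp_card_rcosets S x y.
    by rewrite mem_rcoset conjgE invgK mulgA.
  rewrite FiniteModule.fmodK /= ?im_idm //.
  by rewrite (Burnside_fusion_elt sylS) // groupV.
have co : coprime #|S| #|G : S|.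
  by rewrite (pnat_coprime (pHall_pgroup sylS)) //; case/and3P: sylS.
move=> /(congr1 (fun z => z ^+ expg_invn S #|G : S|)).
by rewrite expgK // expg1n => ->; rewrite inE.
Qed.

(** [N / 'C_N(S)] embeds in [Aut S], of order [p.-1 * p ^ m]. As [S] is abelian, a prime [q]
    dividing the order of this quotient divides [#|G : S|], so [q] differs from [p] and, by
    minimality of [p], exceeds [p.-1]. *)
Lemma norm_sub_cent_cyclic_Sylow_pdiv (gT : finGroupType) (G S : {group gT}) :
    (pdiv #|G|).-Sylow(G) S -> cyclic S -> 'N_G(S) \subset 'C(S).
Proof.
set p := pdiv _ => sylS cycS; have [sSG pS p'i] := and3P sylS.
have [-> | ntS] := eqsVneq S 1; first by rewrite cents1.
have [p_pr _ [m oS]] := pgroup_pdiv pS ntS.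
set N := 'N_G(S); have nSN : N \subset 'N(S) := subsetIr _ _.
have sSC : S \subset 'C_N(S).
  by rewrite !subsetI sSG normG; exact: cyclic_abelian cycS.
have oN : #|conj_aut S @* N| = #|N : 'C_N(S)|.
  rewrite -(card_isog (first_isog_loc (conj_aut S) nSN)) ker_conj_aut.
  by rewrite card_quotient // normsI ?normG ?norms_cent.
apply/setIidPl/eqP; rewrite eqEsubset subsetIl -indexg_eq1 -oN /=.
apply: contraT; set n := #|_| => n_neq1.
have n_gt1 : 1 < n by rewrite ltn_neqAle eq_sym n_neq1 cardG_gt0.
pose q := pdiv n; have q_pr : prime q := pdiv_prime n_gt1.
have qn : q %| n := pdiv_dvd n.
have q_aut : q %| p.-1 * p ^ m.
  rewrite -[m]/(m.+1.-1) -totient_pfactor // -oS -card_Aut_cyclic //.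
  by rewrite (dvdn_trans qn) // cardSg // Aut_conj_aut.
have qNC : q %| #|N : 'C_N(S)| by rewrite -oN.
have qi : q %| #|G : S|.
  rewrite (dvdn_trans qNC) // (dvdn_trans (indexgS _ sSC)) //.
  rewrite -(Lagrange_index (subsetIl G 'N(S))) ?dvdn_mull //.
  by rewrite subsetI sSG normG.
have le_pq : p <= q.
  by rewrite pdiv_min_dvd ?prime_gt1 // (dvdn_trans qi) // dvdn_indexg.
have neq_qp : q != p.
  by have := pnatPpi p'i; apply; rewrite mem_primes q_pr indexg_gt0.
move: q_aut; rewrite Euclid_dvdM // Euclid_dvdX // (dvdn_prime2 q_pr p_pr) (negPf neq_qp).
have p_gt1 := prime_gt1 p_pr; rewrite orbF => /dvdn_leq le_q_p1.
have : q <= p.-1 by rewrite le_q_p1 // -subn1 subn_gt0.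
by rewrite leqNgt -[_ < q]/(p.-1.+1 <= q) prednK ?prime_gt0 // le_pq.
Qed.

(** By Cauchy, [H] has a subgroup of order [#|A|]. A conjugate of it lies with [A] in one cyclic
    Sylow subgroup, which has a single subgroup of that order; normality of [A] undoes the
    conjugation. *)
Lemma prime_order_normal_unique (gT : finGroupType) (G A H : {group gT}) :
    Zgroup G -> A <| G -> prime #|A| -> H \subset G -> #|A| %| #|H| ->
  A \subset H.
Proof.
move=> ZG /andP[sAG nAG] pA sHG pH; set p := #|A| in pA pH.
have [y Hy oy] := Cauchy pA pH.
have [P sylP] := Sylow_exists p G.
have cycP : cyclic P by rewrite (forall_inP ZG) // (p_Sylow sylP).
have pgA : p.-group A by rewrite /pgroup pnat_id.
have pgy : p.-group <[y]> by rewrite /pgroup -orderE oy pnat_id.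
have [a Ga] := Sylow_Jsub sylP sAG pgA; rewrite (normsP nAG) // => sAP.
have syG : <[y]> \subset G by rewrite cycle_subG (subsetP sHG).
have [b Gb syP] := Sylow_Jsub sylP syG pgy.
have /eqP defA : A :==: <[y]> :^ b.
  by rewrite (eq_subG_cyclic cycP) // cardJg -orderE oy.
by rewrite -(conjSg _ _ b) (normsP nAG b Gb) defA conjSg cycle_subG.
Qed.

Lemma Zgroup_sol (gT : finGroupType) (G : {group gT}) : Zgroup G -> solvable G.
Proof.
have [n] := ubnP #|G|; elim: n G => // n IHn G /ltnSE-leGn ZG.
have [-> | ntG] := eqsVneq G 1; first exact: solvable1.
have [S sylS] := Sylow_exists (pdiv #|G|) G.
have cycS : cyclic S by rewrite (forall_inP ZG) // (p_Sylow sylS).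
have tiSG' := Burnside_der1_TI sylS (cyclic_abelian cycS)
  (norm_sub_cent_cyclic_Sylow_pdiv sylS cycS).
have sG'G := der_sub 1 G.
have ltG'G : #|G^`(1)| < #|G|.
  rewrite proper_card // properEneq sG'G andbT.
  apply: contra_eq_neq tiSG' => ->; rewrite (setIidPl (pHall_sub sylS)).
  by rewrite trivg_card1 (card_Hall sylS) p_part_eq1 pi_pdiv cardG_gt1 ntG.
rewrite (series_sol (der_normal 1 G)) (abelian_sol (sub_der1_abelian _)) // andbT.
by apply: IHn (ZgroupS _ ZG) => //; apply: leq_trans leGn.
Qed.

Lemma Zgroup_minnormal_prime (gT : finGroupType) (G : {group gT}) :
  Zgroup G -> G :!=: 1 -> exists2 A : {group gT}, A <| G & prime #|A|.
Proof.
move=> ZG ntG.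
have [A [sAG nsAG ntA]] :=
  solvable_norm_abelem (Zgroup_sol ZG) (normal_refl G) ntG.
case/is_abelemP=> p p_pr abA; exists A => //.
rewrite (cyclic_abelem_prime abA) // nil_Zgroup_cyclic ?(ZgroupS sAG) //.
exact/abelian_nil/(abelem_abelian abA).
Qed.

Lemma Zgroup_subgroup_exists (gT : finGroupType) (G : {group gT}) d :
  Zgroup G -> d %| #|G| -> exists2 H : {group gT}, H \subset G & #|H| = d.
Proof.
have [n] := ubnP #|G|; elim: n gT G d => // n IHn gT G d /ltnSE-leGn ZG dG.
have [G1 | ntG] := eqsVneq G 1.
  by exists 1%G; rewrite ?sub1G // cards1; move: dG; rewrite G1 cards1 dvdn1 => /eqP.
have [A nsAG pA] := Zgroup_minnormal_prime ZG ntG.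
have [sAG nAG] := andP nsAG.
have ltGA : #|G / A| < n.
  by apply: leq_trans leGn; rewrite ltn_quotient // -cardG_gt1 prime_gt1.
have oG : #|G| = (#|G / A| * #|A|)%N.
  by rewrite card_quotient // mulnC Lagrange.
have lift e : e %| #|G / A| -> exists2 H : {group gT},
    A \subset H /\ H \subset G & #|H| = (e * #|A|)%N.
  move=> /(IHn _ _ _ ltGA (morphim_Zgroup _ ZG))[Hb sHG <-].
  have [H defH sAH sHG1] := inv_quotientS nsAG sHG; exists H => //.
  by rewrite defH card_quotient ?(subset_trans sHG1) // mulnC Lagrange.
have [/dvdnP[e def_d] | A'd] := boolP (#|A| %| d).
  have /lift[H [_ sHG] oH] : e %| #|G / A|.
    by rewrite -(dvdn_pmul2r (prime_gt0 pA)) -def_d -oG.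
  by exists H; rewrite ?def_d.
(* Here [L] of order [d * #|A|] has [A] as a normal Hall subgroup, and a complement of [A] in [L]
   has order [d]. *)
have coAd : coprime #|A| d by rewrite prime_coprime.
have /lift[L [sAL sLG] oL] : d %| #|G / A|.
  by rewrite -(@Gauss_dvdl d _ #|A|) -?oG // coprime_sym.
have nsAL : A <| L by rewrite (normalS sAL sLG).
have oLA : #|L : A| = d by rewrite -divgS // oL mulnK ?prime_gt0.
have hallA : Hall L A by rewrite /Hall sAL oLA.
have /splitsP[H /complP[tiAH defL]] := SchurZassenhaus_split hallA nsAL.
exists H; first by rewrite (subset_trans _ sLG) // -defL mulG_subr.
apply/eqP; rewrite -(eqn_pmul2l (prime_gt0 pA)) -(TI_cardMg tiAH) defL oL.
by rewrite mulnC.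
Qed.

Lemma Zgroup_subgroup_conj (gT : finGroupType) (G H K : {group gT}) :
    Zgroup G -> H \subset G -> K \subset G -> #|H| = #|K| ->
  exists2 x, x \in G & K :=: H :^ x.
Proof.
have [n] := ubnP #|G|; elim: n gT G H K => // n IHn gT G H K.
move=> /ltnSE-leGn ZG sHG sKG oHK.
have [G1 | ntG] := eqsVneq G 1.
  exists 1; rewrite // conjsg1; move: sHG sKG; rewrite G1.
  by move=> /trivGP-> /trivGP->.
have [A nsAG pA] := Zgroup_minnormal_prime ZG ntG.
have [sAG nAG] := andP nsAG.
have ltGA : #|G / A| < n.
  by apply: leq_trans leGn; rewrite ltn_quotient // -cardG_gt1 prime_gt1.
have [nHA nKA] := (subset_trans sHG nAG, subset_trans sKG nAG).
(* Induction makes the images conjugate in [G / A]; the conjugating element is lifted to [G]. *)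
have conjA : #|H / A| = #|K / A| ->
    exists2 x, x \in G & K / A = (H :^ x) / A.
  move=> oHKA.
  have [_ /morphimP[x Nx Gx ->] ->] := IHn _ _ _ _ ltGA (morphim_Zgroup _ ZG)
    (quotientS A sHG) (quotientS A sKG) oHKA.
  by exists x; rewrite ?quotientJ.
have [AH | A'H] := boolP (#|A| %| #|H|).
  have sAH := prime_order_normal_unique ZG nsAG pA sHG AH.
  have sAK : A \subset K.
    by apply: prime_order_normal_unique ZG nsAG pA sKG _; rewrite -oHK.
  have [|x Gx eqKH] := conjA.
    by rewrite !card_quotient // -!divgS // oHK.
  (* Both [K] and [H :^ x] contain [A], so equal quotients force equality. *)
  exists x => //; apply: quotient_inj eqKH; first exact: normalS sAK sKG nsAG.
  rewrite /normal -{1}(normsP nAG x Gx) conjSg sAH.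
  by rewrite (subset_trans _ nAG) // -(conjGid Gx) conjSg.
have coA (T : {group gT}) : T \subset G -> #|T| = #|H| -> #|T / A| = #|T|.
  move=> sTG oT; apply/esym/card_isog/quotient_isog; first exact: subset_trans nAG.
  by rewrite coprime_TIg // oT prime_coprime.
have [|x Gx eqKH] := conjA; first by rewrite !coA.
have sHxG : H :^ x \subset G by rewrite -(conjGid Gx) conjSg.
(* Now [K] and [H :^ x] are complements of [A] in the same product, hence conjugate by some [a] in
   [A]. *)
have sKAH : K \subset A * (H :^ x)%G by rewrite -quotientSK // eqKH.
have [||||a Aa ->] := SchurZassenhaus_trans_sol _ _ sKAH.
- exact: abelian_sol (cyclic_abelian (prime_cyclic pA)).
- exact: subset_trans nAG.
- by rewrite cardJg prime_coprime.
- by rewrite cardJg.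
by exists (x * a); rewrite ?groupM ?conjsgM // (subsetP sAG).
Qed.

Local Close Scope group_scope.

Theorem theorem61 (gT : finGroupType) (G : {group gT}) (N d : nat)
    (hG : Zgroup G) (hN : #|G| = N) (hd : d %| N) :
  (exists H : {group gT}, H \subset G /\ #|H| = d) /\
  (forall H K : {group gT},
     H \subset G -> K \subset G -> #|H| = d -> #|K| = d ->
     exists x : gT, x \in G /\ K :=: (H :^ x)%g).
Proof.
split.
  by have [|H sHG oH] := Zgroup_subgroup_exists (d := d) hG; [rewrite hN | exists H].
move=> H K sHG sKG oH oK.
have [|x Gx defK] := Zgroup_subgroup_conj hG sHG sKG; first by rewrite oH.
by exists x.
Qed.
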